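(* Let $q$ be an odd prime power, $t\ge3$ an integer, $W=\{x\in\mathbb{F}_{q^{2t}} : x^{q^t}+x=0\}$, and $\sigma=q^J$ with $J\in\{1,\ldots,2t-1\}$, $\gcd(J,2t)=1$. If $m\in\mathbb{F}_{q^t}$ is neither a $(q-1)$-th power nor a $(q+1)$-th power of any element of $W$, then the $q$-polynomial \[\varphi_{m,\sigma}=X^{\sigma^{t-1}}+X^{\sigma^{2t-1}}+m\left(X^{\sigma}-X^{\sigma^{t+1}}\right)\in\mathbb{F}_{q^{2t}}[X]\] is scattered.
   Context: $q$-polynomials over $\mathbb{F}_{q^{2t}}$ are considered modulo $X^{q^{2t}}-X$ and identified with the corresponding $\mathbb{F}_q$-linear maps. A $q$-polynomial $f$ over $\mathbb{F}_{q^{2t}}$ is scattered if for all $x,y\in\mathbb{F}_{q^{2t}}^*$, $f(x)/x=f(y)/y$ implies $x/y\in\mathbb{F}_q$. *)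

(* Defs.v *)
From HB Require Import structures.
From mathcomp Require Import all_boot all_order all_algebra all_field.

Set Implicit Arguments.
Unset Strict Implicit.
Unset Printing Implicit Defensive.

Import GRing.Theory.
Local Open Scope ring_scope.

(* The ground field F_q is F, so q = #|F|; F_{q^n} is an extension L of F of  *)
(* degree n.  Inside L, the subfield F_q is 1%VS.                             *)

Definition is_qpoly (F : finFieldType) (L : fieldExtType F) (f : {poly L}) :
    Prop :=
  exists (n : nat) (c : nat -> L), f = \sum_(i < n) c i *: 'X^(#|F| ^ i)%N.

(* Only the values of f on L matter for the second conjunct, so it depends    *)
(* only on the class of f modulo 'X^(q ^ n) - 'X; no reduced representative   *)
(* needs to be chosen.                                                        *)
Definition scattered (F : finFieldType) (L : fieldExtType F) (f : {poly L}) :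
    Prop :=
  is_qpoly f /\
  forall x y : L, x != 0 -> y != 0 -> f.[x] / x = f.[y] / y -> x / y \in 1%VS.

Definition W (R : nzRingType) (q t : nat) : pred R :=
  [pred x | x ^+ (q ^ t)%N + x == 0].

Definition phi (R : nzRingType) (t sigma : nat) (m : R) : {poly R} :=
  'X^(sigma ^ (t - 1))%N + 'X^(sigma ^ (2 * t - 1))%N
  + m *: ('X^sigma - 'X^(sigma ^ (t + 1))%N).

(* Main.v *)
Require Import Defs.
From HB Require Import structures.
From mathcomp Require Import all_boot all_order all_algebra all_field.
From mathcomp Require Import pgroup abelian.
From mathcomp Require Import zify ring.

Set Implicit Arguments.
Unset Strict Implicit.
Unset Printing Implicit Defensive.

Import GRing.Theory.
Local Open Scope ring_scope.

(** Split x = a + b and y / x = h + r into eigenvectors of the involution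
    z |-> z ^+ (q ^ t), with eigenvalues 1 and -1, and write s for the sigma-power
    map, generating the Galois group over F_q.  Comparing components in
    phi(y) x = phi(x) y shows that U = m r b s(b) and V = r s^-1(a) a, both in W,
    satisfy U - V = m s(U - V).  If U <> V, then m is the (sigma - 1)-th power
    of an element of W.  If U = V, then either m = w s(w) for w = s^-1(a) / b
    in W, or r = 0, in which case s fixes h = y / x.  As J is odd, the integers
    (sigma - 1) / (q - 1) and (sigma + 1) / (q + 1) are odd, and odd powers
    preserve W. *)

(** * Trichotomy for an involution commuting with an automorphism *)

Section Alternative.

Variables (R : fieldType) (c s s' : {rmorphism R -> R}) (m : R).
Hypotheses (two_neq0 : 2%:R != 0 :> R).
Hypotheses (cK : involutive c) (s'K : cancel s' s) (sK : cancel s s').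
Hypotheses (cs : forall x, c (s x) = s (c x)) (cm : c m = m).

Lemma involution_split x : exists a b, [/\ x = a + b, c a = a & c b = - b].
Proof.
exists ((x + c x) / 2%:R), ((x - c x) / 2%:R).
split; first by field.
  by rewrite fmorph_div rmorphD cK rmorph_nat addrC.
by rewrite fmorph_div rmorphB cK rmorph_nat -mulNr opprB.
Qed.

Lemma involution_split_inj a b a' b' :
    c a = a -> c a' = a' -> c b = - b -> c b' = - b' ->
  a + b = a' + b' -> a = a' /\ b = b'.
Proof.
move=> ca ca' cb cb' e.
have : c (a + b) = c (a' + b') by rewrite e.
rewrite !rmorphD ca ca' cb cb' => e'.
suff ea : a = a' by split=> //; move: e; rewrite ea => /addrI.
apply: (mulfI two_neq0).
have -> : 2%:R * a = (a + b) + (a - b) by ring.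
by rewrite e e'; ring.
Qed.

(** Here [c] stands for the q^t-power, [s] for the sigma-power and [s'] for its inverse, so that [f]
    is the map of [phi] and [rho] is y / x. *)
Lemma scattered_alternative x rho :
    let f z := s' (z + c z) + m * s (z - c z) in
    x != 0 -> f (rho * x) = rho * f x ->
  [\/ s rho = rho,
      exists2 w, c w = - w & w != 0 /\ w = m * s w |
      exists2 w, c w = - w & m = w * s w].
Proof.
move=> f x0.
(* m = 0 has the third form with w = 0; otherwise m can be cancelled below. *)
have [m0|m0] := eqVneq m 0.
  by move=> _; apply: Or33; exists 0; rewrite ?rmorph0 ?oppr0 ?mul0r.
have [a [b [ex ca cb]]] := involution_split x; rewrite {x}ex in x0 *.
have [h [r [-> ch cr]]] := involution_split rho.
have cs' z : c (s' z) = s' (c z) by rewrite -{2}(s'K z) cs sK.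
have fE k w : c k = k -> c w = - w -> f (k + w) = 2%:R * (s' k + m * s w).
  move=> ck cw; rewrite /f (rmorphD c) ck cw.
  have -> : k + w + (k - w) = 2%:R * k by ring.
  have -> : k + w - (k - w) = 2%:R * w by ring.
  by rewrite !rmorphM !rmorph_nat; ring.
have -> : (h + r) * (a + b) = (h * a + r * b) + (h * b + r * a) by ring.
have ck : c (h * a + r * b) = h * a + r * b.
  by rewrite rmorphD !rmorphM ch ca cr cb mulrNN.
have cw : c (h * b + r * a) = - (h * b + r * a).
  by rewrite rmorphD !rmorphM ch ca cr cb mulrN mulNr opprD.
rewrite !fE // mulrCA => /(mulfI two_neq0).
set a' := s' a; have sa' : s a' = a by apply: s'K.
have ca' : c a' = a' by rewrite cs' ca.
have -> : (h + r) * (a' + m * s b) =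
  (h * a' + r * (m * s b)) + (r * a' + h * m * s b) by ring.
case/involution_split_inj.
- by rewrite cs' ck.
- by rewrite rmorphD !rmorphM ch ca' cr cm cs cb rmorphN; ring.
- by rewrite rmorphM cm cs cw rmorphN mulrN.
- by rewrite rmorphD !rmorphM ch ca' cr cm cs cb rmorphN; ring.
move=> /(congr1 s); rewrite s'K !(rmorphD, rmorphM) sa' => e1 e2.
have [r0|r0] := eqVneq r 0.
  (* Now rho = h. Cancel a in [e1] if a != 0; otherwise b != 0, since x != 0, and m s(b) cancels in
     [e2]. *)
  apply: Or31; rewrite r0 addr0 !(rmorph0, mul0r, addr0, add0r) in e1 e2 *.
  have [a0|a0] := eqVneq a 0; last by apply/(mulIf a0).
  have b0 : m * s b != 0.
    by rewrite mulf_neq0 // fmorph_eq0; rewrite a0 add0r in x0.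
  by apply: (mulIf b0); rewrite mulrCA e2 mulrA.
pose D := m * r * b * s b - r * a' * a.
have cD : c D = - D.
  by rewrite /D rmorphB !rmorphM cs cm cr cb ca ca' rmorphN; ring.
have DE : D = m * s D.
  apply/subr0_eq; rewrite /D rmorphB !rmorphM sa'.
  (* Weighting [e1] by m s(b) and [e2] by a makes all terms in h and s(h) cancel; what is left is D
     - m s(D). *)
  transitivity (m * s b * (h * a + r * b - (s h * a + s r * (s m * s (s b))))
    + a * (m * (s h * s b + s r * s a) - (r * a' + h * m * s b))).
    by ring.
  by rewrite e1 e2; ring.
have [D0|D0] := eqVneq D 0; last by apply: Or32; exists D.
(* If b = 0, then D = 0 and r != 0 force a = 0, against x != 0. *)
apply: Or33; have [b0|b0] := eqVneq b 0.
  move: D0; rewrite /D b0 mulr0 mul0r sub0r => /eqP.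
  rewrite oppr_eq0 !mulf_eq0 (negPf r0) fmorph_eq0 orbb => /eqP a0.
  by rewrite a0 b0 addr0 eqxx in x0.
have sb0 : s b != 0 by rewrite fmorph_eq0.
exists (a' / b); first by rewrite fmorph_div ca' cb invrN mulrN.
rewrite fmorph_div sa'; apply: (mulfI r0); apply: (mulIf b0); apply: (mulIf sb0).
by rewrite (mulrC r m) (subr0_eq D0); field; rewrite sb0.
Qed.

End Alternative.

(** * Arithmetic of odd exponents *)

(** This makes the sigma^t-power coincide with the q^t-power on a field of degree 2t. *)
Lemma modn_odd_mul t J : odd J -> (J * t = t %[mod 2 * t])%N.
Proof.
move=> oJ; rewrite -{1}(odd_double_half J) oJ mulnDl mul1n.
by rewrite -muln2 -mulnA addnC modnMDl.
Qed.

Lemma odd_sum_exp q n : odd q -> odd n -> odd (\sum_(i < n) q ^ i)%N.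
Proof.
move=> oq; suff -> : odd (\sum_(i < n) q ^ i)%N = odd n by [].
elim: n => [|n IH]; first by rewrite big_ord0.
by rewrite big_ord_recr oddD IH oddX oq orbT /= addbT.
Qed.

Lemma expn_add1_odd_factor q n :
  odd q -> odd n -> exists2 k, odd k & (q ^ n + 1 = (q + 1) * k)%N.
Proof.
move=> oq on; rewrite -(odd_double_half n) on add1n -muln2.
have q0 : (0 < q)%N by case: q oq.
elim: (n./2) => [|i [k ok e]]; first by exists 1%N; rewrite ?muln1.
have k0 : (0 < k)%N by case: k ok {e}.
have le : (q - 1 <= q ^ 2 * k)%N.
  by rewrite expnS expn1 -mulnA; nia.
(* From q^(n+2) + 1 = q^2 (q^n + 1) - (q + 1)(q - 1); [le] keeps the subtraction from truncating. *)
exists (q ^ 2 * k - (q - 1))%N.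
  by rewrite oddB // oddM oddX oq ok oddB // oq.
rewrite mulnBr (mulnCA (q + 1)%N) -e mulnDr -expnD muln1.
rewrite (_ : 2 + (i * 2).+1 = (i.+1 * 2).+1)%N; last by lia.
by nia.
Qed.

(** * Powers of the Frobenius map of L over F *)

Section Frobenius.

Variables (F : finFieldType) (L : fieldExtType F).

Definition frob (k : nat) (x : L) : L := x ^+ (#|F| ^ k)%N.

(** The additive group of F is an elementary abelian p-group, so q is a power of p. *)
Lemma pchar_nat_card : [pchar L].-nat #|F|.
Proof.
have [p p_pr pF] := finPcharP F.
have pcharL : p \in [pchar L] by rewrite pchar_lalg.
have := abelem_pgroup (fin_ring_pchar_abelem pF).
by rewrite /pgroup cardsT (eq_pnat _ (pcharf_eq pcharL)).
Qed.

Lemma pchar_nat_cardX k : [pchar L].-nat (#|F| ^ k)%N.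
Proof. by rewrite pnatX pchar_nat_card. Qed.

Lemma frob_zmod_morphism k : zmod_morphism (frob k).
Proof.
move=> x y; rewrite /frob exprDn_pchar ?pchar_nat_cardX //.
by rewrite exprNn_pchar ?pchar_nat_cardX.
Qed.

Lemma frob_monoid_morphism k : monoid_morphism (frob k).
Proof. by split=> [|x y]; rewrite /frob ?expr1n ?exprMn. Qed.

HB.instance Definition _ k :=
  GRing.isZmodMorphism.Build L L (frob k) (frob_zmod_morphism k).
HB.instance Definition _ k :=
  GRing.isMonoidMorphism.Build L L (frob k) (frob_monoid_morphism k).

Lemma frob_frob i j x : frob i (frob j x) = frob (i + j) x.
Proof. by rewrite /frob -exprM -expnD addnC. Qed.

Lemma frob_period x : frob (\dim {:L}) x = x.
Proof. by apply/eqP; rewrite -Fermat's_little_theorem memvf. Qed.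

Lemma frob_modn i x : frob (i %% \dim {:L}) x = frob i x.
Proof.
rewrite [in RHS](divn_eq i (\dim {:L})) -frob_frob.
elim: (i %/ _)%N => [|n IH]; first by rewrite mul0n [RHS]expr1.
by rewrite mulSn -frob_frob frob_period.
Qed.

Lemma eqmod_frob i j x : i = j %[mod \dim {:L}] -> frob i x = frob j x.
Proof. by rewrite -(frob_modn i) -(frob_modn j) => ->. Qed.

Lemma frob_mul_fixed i n x : frob i x = x -> frob (n * i) x = x.
Proof.
move=> e; elim: n => [|n IH]; first by rewrite mul0n [LHS]expr1.
by rewrite mulSn -frob_frob IH.
Qed.

(** By Bezout some multiple of J is 1 modulo the degree, so x is fixed by the q-power map, whose
    fixed field is F. *)
Lemma coprime_frob_fixed J x :
  (0 < J)%N -> coprime J (\dim {:L}) -> frob J x = x -> x \in 1%VS.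
Proof.
move=> J0 /(coprimeP _ J0)[[u v] /= e] fx.
have e' : (u * J = v * \dim {:L} + 1)%N by lia.
have := frob_mul_fixed u fx.
rewrite (@eqmod_frob _ 1%N) ?e' ?modnMDl // => f1.
by rewrite (Fermat's_little_theorem 1%AS) dimv1; apply/eqP.
Qed.

Lemma two_neq0_odd_card : odd #|F| -> 2%:R != 0 :> L.
Proof.
move=> oF; apply/eqP => two0.
have c2 : 2%N \in [pchar L] by rewrite inE /= two0 eqxx.
have := pchar_nat_card; rewrite (eq_pnat _ (pcharf_eq c2)).
move/p_natP=> [k e]; move: oF (finNzRing_gt1 F); rewrite e.
by case: k {e} => // k; rewrite expnS oddM.
Qed.

(** * Closure properties of q-polynomials *)

Lemma is_qpolyD (f g : {poly L}) : is_qpoly f -> is_qpoly g -> is_qpoly (f + g).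
Proof.
have widen n k (c : nat -> L) : (n <= k)%N ->
  \sum_(i < n) c i *: 'X^(#|F| ^ i)%N =
  \sum_(i < k) (if (i < n)%N then c i else 0) *: 'X^(#|F| ^ i)%N.
  move=> nk; rewrite (big_ord_widen k (fun i => c i *: 'X^(#|F| ^ i)%N) nk).
  rewrite big_mkcond; apply: eq_bigr => i _.
  by case: ifP => // _; rewrite scale0r.
move=> [n [c ->]] [n' [c' ->]].
exists (maxn n n'), (fun i =>
  (if (i < n)%N then c i else 0) + (if (i < n')%N then c' i else 0)).
rewrite (widen _ _ c (leq_maxl n n')) (widen _ _ c' (leq_maxr n n')) -big_split.
by apply: eq_bigr => i _; rewrite scalerDl.
Qed.

Lemma is_qpolyZ a (f : {poly L}) : is_qpoly f -> is_qpoly (a *: f).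
Proof.
move=> [n [c ->]]; exists n, (fun i => a * c i).
by rewrite scaler_sumr; apply: eq_bigr => i _; rewrite scalerA.
Qed.

Lemma is_qpolyXn k : is_qpoly ('X^(#|F| ^ k)%N : {poly L}).
Proof.
exists k.+1, (fun i => (i == k)%:R).
rewrite big_ord_recr /= eqxx scale1r big1 ?add0r // => i _.
by rewrite ltn_eqF ?scale0r.
Qed.

Lemma is_qpoly_phi t J (m : L) : is_qpoly (phi t (#|F| ^ J)%N m).
Proof.
rewrite /phi -!expnM -scaleN1r.
by do ![apply: is_qpolyD | apply: is_qpolyZ | apply: is_qpolyXn].
Qed.

(** * The set W and the values of phi *)

Lemma mem_W t (w : L) : (w \in W #|F| t) = (frob t w == - w).
Proof. by rewrite inE -addr_eq0. Qed.

Lemma W_exp_odd t n (w : L) : odd n -> w \in W #|F| t -> w ^+ n \in W #|F| t.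
Proof.
rewrite !mem_W => on /eqP e; rewrite rmorphXn /= e.
by rewrite exprNn -signr_odd on expr1 mulN1r.
Qed.

Lemma horner_phi t J m x :
    (0 < t)%N -> \dim {:L} = (2 * t)%N -> odd J ->
  (phi t (#|F| ^ J)%N m).[x] =
  frob (J * (2 * t - 1)) (x + frob t x) + m * frob J (x - frob t x).
Proof.
move=> t_gt0 dimL J_odd; have Jt := modn_odd_mul t J_odd.
rewrite /phi !hornerE -!expnM.
rewrite rmorphD rmorphB /= !frob_frob.
congr (_ + _); last congr (_ * (_ - _)).
  rewrite addrC; congr (_ + _); apply: eqmod_frob; rewrite dimL.
  (* Modulo 2t, J(2t - 1) + t is J(2t - 1) + Jt, which is J(t - 1). *)
  rewrite -[RHS]modnDmr -Jt modnDmr.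
  rewrite (_ : _ + _ * t = J * (2 * t) + J * (t - 1))%N ?modnMDl //; nia.
by apply: eqmod_frob; rewrite dimL mulnDr muln1 addnC -modnDmr Jt modnDmr.
Qed.

Lemma W_frobenius_quotient t J (m w : L) :
    odd #|F| -> odd J -> w \in W #|F| t -> w != 0 -> w = m * frob J w ->
  exists2 v, v \in W #|F| t & m = v ^+ (#|F| - 1)%N.
Proof.
move=> q_odd J_odd wW w0 e; exists (w^-1 ^+ (\sum_(i < J) #|F| ^ i)%N).
  apply: W_exp_odd; first exact: odd_sum_exp.
  by move: wW; rewrite !mem_W fmorphV /= => /eqP->; rewrite invrN.
rewrite -exprM mulnC subn1 -predn_exp; apply: (mulIf w0).
have q0 : (0 < #|F| ^ J)%N by rewrite expn_gt0 odd_gt0.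
have wJ0 : frob J w != 0 by rewrite expf_neq0.
apply: (mulIf wJ0).
rewrite mulrAC -e exprVn /frob -[in RHS](prednK q0) exprS /=.
by rewrite -mulrA [w * (w * _)]mulrA [w * w * _]mulrC mulKf // expf_neq0.
Qed.

Lemma W_frobenius_product t J (m w : L) :
    odd #|F| -> odd J -> w \in W #|F| t -> m = w * frob J w ->
  exists2 v, v \in W #|F| t & m = v ^+ (#|F| + 1)%N.
Proof.
move=> q_odd J_odd wW e; have [k ok ek] := expn_add1_odd_factor q_odd J_odd.
exists (w ^+ k); first exact: W_exp_odd.
by rewrite -exprM mulnC -ek addn1 exprS.
Qed.

End Frobenius.

Theorem theorem2p3 (q t J : nat) (F : finFieldType) (L : fieldExtType F)
    (K : {subfield L}) (m : L)
    (hF : #|F| = q) (q_odd : odd q) (ht : (3 <= t)%N)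
    (hL : \dim {:L} = (2 * t)%N) (hK : \dim K = t)
    (hJ : (1 <= J <= 2 * t - 1)%N) (hJt : coprime J (2 * t))
    (hm : m \in K)
    (hm1 : ~ exists2 w : L, w \in W q t & m = w ^+ (q - 1)%N)
    (hm2 : ~ exists2 w : L, w \in W q t & m = w ^+ (q + 1)%N) :
  scattered (phi t (q ^ J)%N m).
Proof.
subst q; split; first exact: is_qpoly_phi.
have oJ : odd J by move: hJt; rewrite coprimeMr coprimen2 => /andP[].
have [J0 _] := andP hJ.
have t1 : (0 < t)%N by apply: leq_trans ht.
have cm : frob t m = m by apply/eqP; rewrite -hK -Fermat's_little_theorem.
have inv n i (x : L) : (n + i)%N = 0 %[mod 2 * t] -> frob n (frob i x) = x.
  by move=> e; rewrite frob_frob (@eqmod_frob _ _ _ 0%N) ?hL // [LHS]expr1.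
(* Hence the sigma^(2t-1)-power inverts the sigma-power. *)
have e2t : (J * (2 * t - 1) + J = J * (2 * t))%N by nia.
(* Pass to y / x, the ratio [rho] of the trichotomy. *)
move=> x y x0 y0 exy; rewrite -[x / y]invrK invf_div memvV.
apply: (coprime_frob_fixed J0); first by rewrite hL.
have [] := @scattered_alternative L (frob t) (frob J)
  (frob (J * (2 * t - 1))) m _ _ _ _ _ cm x (y / x) x0.
- exact: two_neq0_odd_card.
- by move=> z; apply: inv; rewrite addnn -mul2n modnn mod0n.
- by move=> z; apply: inv; rewrite addnC e2t modnMl mod0n.
- by move=> z; apply: inv; rewrite e2t modnMl mod0n.
- by move=> z; rewrite /= !frob_frob addnC.
- by rewrite -!horner_phi // divfK // -mulrA (mulrC x^-1) exy mulrCA divff ?mulr1.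
- by [].
- move=> [w cw [w0 ew]]; case: hm1; apply: (W_frobenius_quotient _ oJ _ w0 ew) => //.
  by rewrite mem_W cw.
- move=> [w cw ew]; case: hm2; apply: (W_frobenius_product _ oJ _ ew) => //.
  by rewrite mem_W cw.
Qed.
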